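(* For each natural number $n\ge1$, the monotone graph property ''the graph contains $K_{1,n}$'' is $\mathcal F_n$-hard on the vertex set $\omega$, where $\mathcal F_n=\{E\subseteq[\omega]^2:\exists B\subseteq\omega\text{ with }|B|=n\text{ and }[\omega]^2\setminus E\subseteq[B]^2\}$.
   Context: $K_{1,n}$ is the star with one center and $n$ leaves; a graph contains $K_{1,n}$ iff some vertex has degree at least $n$. Game $\mathbb E_{\omega,R,\mathcal F}$ (for a property $R$ and an upward closed $\mathcal F\subseteq\mathcal P([\omega]^2)$): a pregraph on $\omega$ is $\langle\omega,E,N\rangle$ with $E,N\subseteq[\omega]^2$ disjoint (edges, nonedges; $P=E\cup N$ determined pairs); a graph $\langle\omega,E'\rangle$ extends it if $E\subseteq E'$ and $E'\cap N=\emptyset$. Alice and Bob build a transfinite sequence of pregraphs starting with $\langle\omega,\emptyset,\emptyset\rangle$, taking unions at limits; at successor steps Alice picks an undetermined pair and Bob declares it edge or nonedge. The game terminates at the first stage $\beta$ at which either every graph extending the current pregraph has $R$ or none does. Bob wins iff the set $P_\beta$ of determined pairs at termination belongs to $\mathcal F$. $R$ is $\mathcal F$-hard on $\omega$ iff Alice has no winning strategy in this game. *)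

(* Defs.v *)
From mathcomp Require Import all_boot finmap.
From mathcomp Require Import boolp classical_sets wochoice.

Set Implicit Arguments.
Unset Strict Implicit.
Unset Printing Implicit Defensive.

Local Open Scope classical_set_scope.

(* [V]^2, the two-element subsets of V *)
Definition upair (V : choiceType) : Type := {e : {fset V} | #|` e| == 2}.

(* A graph on V is identified with its edge set, of type [set (upair V)]; a
   property of graphs on V is a set of such edge sets. *)

Definition adjacent (V : choiceType) (E : set (upair V)) (x y : V) : Prop :=
  exists2 e : upair V, E e & sval e = [fset x; y]%fset.

Definition monotone_property (V : choiceType) (R : set (set (upair V))) : Prop :=
  forall E E', E `<=` E' -> R E -> R E'.

Section Game.
Variable V : choiceType.

Record pregraph : Type := Pregraph {
  edges : set (upair V);
  nonedges : set (upair V);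
  edges_nonedges_disjoint : edges `&` nonedges = set0 }.

Definition determined (G : pregraph) : set (upair V) := edges G `|` nonedges G.

Definition extends (E : set (upair V)) (G : pregraph) : Prop :=
  edges G `<=` E /\ E `&` nonedges G = set0.

Definition decided (R : set (set (upair V))) (G : pregraph) : Prop :=
  (forall E, extends E G -> R E) \/ (forall E, extends E G -> ~ R E).

(* G' results from G when Bob declares e an edge (b = true) or a nonedge *)
Definition declares (e : upair V) (b : bool) (G G' : pregraph) : Prop :=
  if b then edges G' = e |` edges G /\ nonedges G' = nonedges G
  else edges G' = edges G /\ nonedges G' = e |` nonedges G.

Section Order.
Variables (I : Type) (le : rel I).

Definition before (j i : I) : Prop := le j i /\ j <> i.

Definition is_zero (i : I) : Prop := ~ exists j, before j i.

Definition is_succ (j i : I) : Prop :=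
  before j i /\ ~ exists k, before j k /\ before k i.

Definition is_limit (i : I) : Prop := ~ is_zero i /\ ~ exists j, is_succ j i.

End Order.

(* A (possibly unfinished) run of the game: a transfinite sequence of pregraphs,
   indexed by the elements of a well-ordered type. Since no stage lies after
   one whose pregraph is decided, a stage with a decided pregraph is the last
   one, and is the stage at which the run terminates. *)
Record run (R : set (set (upair V))) : Type := Run {
  stage : Type;
  stage_le : rel stage;
  stage_wo : well_order stage_le;
  position : stage -> pregraph;
  position_zero : forall i, is_zero stage_le i ->
    edges (position i) = set0 /\ nonedges (position i) = set0;
  position_succ : forall j i, is_succ stage_le j i ->
    exists e b, ~ determined (position j) e /\
      declares e b (position j) (position i);
  position_limit : forall i, is_limit stage_le i ->
    edges (position i) = \bigcup_(j in before stage_le ^~ i) edges (position j)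
    /\ nonedges (position i) =
         \bigcup_(j in before stage_le ^~ i) nonedges (position j);
  undecided_before : forall j i, before stage_le j i ->
    ~ decided R (position j) }.

(* The positions of a run strictly increase along the stages (position_le
   below), so the sequence of positions up to stage i is determined by its
   range. Histories are represented by these ranges, which do not depend on the
   well-ordered type that indexes the run. *)
Definition history (R : set (set (upair V))) (r : run R) (i : stage r) :
    set pregraph :=
  [set position j | j in [set j | stage_le j i]].

Definition alice_strategy (R : set (set (upair V)))
    (sigma : set pregraph -> upair V) : Prop :=
  forall (r : run R) (i : stage r), ~ decided R (position i) ->
    ~ determined (position i) (sigma (history i)).

Definition follows (R : set (set (upair V)))
    (sigma : set pregraph -> upair V) (r : run R) : Prop :=
  forall j i : stage r, is_succ (@stage_le R r) j i ->
    exists b, declares (sigma (history j)) b (position j) (position i).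

(* Every run terminates, as each step determines a new pair; so Alice wins iff
   the set of determined pairs at termination is not in F. *)
Definition alice_winning (R F : set (set (upair V)))
    (sigma : set pregraph -> upair V) : Prop :=
  alice_strategy R sigma /\
  forall (r : run R) (i : stage r), follows sigma r ->
    decided R (position i) -> ~ F (determined (position i)).

Definition upward_closed (F : set (set (upair V))) : Prop :=
  forall A B, A `<=` B -> F A -> F B.

Definition hard (F R : set (set (upair V))) : Prop :=
  ~ exists sigma, alice_winning R F sigma.

End Game.

(* E contains the star with center c and leaf set L, for some c and some
   n-element L. *)
Definition contains_star (n : nat) : set (set (upair nat)) :=
  [set E | exists (c : nat) (L : {fset nat}),
     [/\ #|` L| = n, c \notin L & forall x, x \in L -> adjacent E c x]].

Definition cofinite_family (n : nat) : set (set (upair nat)) :=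
  [set E | exists2 B : {fset nat}, #|` B| = n &
     ~` E `<=` [set e : upair nat | (sval e `<=` B)%fset]].

Lemma contains_star_monotone n : monotone_property (contains_star n).
Proof.
move=> E E' EE' [c [L [Ln cL adj]]]; exists c, L; split=> // x xL.
by have [e Ee eE] := adj x xL; exists e => //; apply: EE'.
Qed.

Lemma cofinite_family_upward_closed n : upward_closed (cofinite_family n).
Proof.
move=> A B AB [C Cn sAC]; exists C => // e nBe; apply: sAC => /= Ae.
exact/nBe/AB.
Qed.

Section RunTheory.
Variables (V : choiceType) (R : set (set (upair V))) (r : run R).
Implicit Types i j k : stage r.
Local Notation le := (@stage_le V R r).

Lemma stage_min (P : stage r -> Prop) :
  (exists i, P i) -> exists2 i, P i & forall j, P j -> le i j.
Proof.
move=> [i Pi]; have [|z [[zP zmin] _]] := stage_wo (r := r) (A := [pred x | `[< P x >]]).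
  by exists i; rewrite inE.
exists z; first by move: zP; rewrite inE.
by move=> j Pj; apply: zmin; rewrite inE.
Qed.

Lemma stage_le_total i j : le i j \/ le j i.
Proof.
have [|z [] -> zmin] := @stage_min (fun k => k = i \/ k = j).
- by exists i; left.
- by left; apply: zmin; right.
- by right; apply: zmin; left.
Qed.

Lemma stage_lexx i : le i i.
Proof. by case: (stage_le_total i i). Qed.

Lemma stage_le_anti i j : le i j -> le j i -> i = j.
Proof.
move=> ij ji; have [|z [_ uz]] := stage_wo (r := r)
    (A := [pred x | `[< x = i \/ x = j >]]).
  by exists i; rewrite inE; left.
have zi : z = i.
  apply: uz; split; first by rewrite inE; left.
  by move=> x; rewrite inE => -[->|->] //; exact: stage_lexx.
rewrite -zi; apply: uz; split; first by rewrite inE; right.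
by move=> x; rewrite inE => -[->|->] //; exact: stage_lexx.
Qed.

Lemma stage_le_trans i j k : le i j -> le j k -> le i k.
Proof.
move=> ij jk.
have [|z zP zmin] := @stage_min (fun l => [\/ l = i, l = j | l = k]).
  by exists i; constructor 1.
have zi : le z i by apply: zmin; constructor 1.
have zj : le z j by apply: zmin; constructor 2.
have zk : le z k by apply: zmin; constructor 3.
case: zP => zE; move: zi zj zk; rewrite zE // => zi zj zk.
- by rewrite (stage_le_anti ij zi).
- by rewrite -(stage_le_anti jk zj).
Qed.

Lemma position_lt i j : before le j i ->
  [/\ edges (position j) `<=` edges (position i),
      nonedges (position j) `<=` nonedges (position i)
    & exists2 e, determined (position i) e & ~ determined (position j) e].
Proof.
pose P i := forall j, before le j i ->
  [/\ edges (position j) `<=` edges (position i),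
      nonedges (position j) `<=` nonedges (position i)
    & exists2 e, determined (position i) e & ~ determined (position j) e].
move: j; rewrite -/(P i); apply: contrapT => nPi.
have [|{nPi}i nPi imin] := @stage_min (fun i => ~ P i); first by exists i.
have IH k : before le k i -> P k.
  by move=> [ki nki]; apply: contrapT => /imin ik; apply: nki; apply: stage_le_anti.
apply: nPi => j ji; have [[k ki]|nsucc] := pselect (exists k, is_succ le k i).
- have [e [b [nke dec]]] := position_succ ki.
  have [ek nk ie] : [/\ edges (position k) `<=` edges (position i),
      nonedges (position k) `<=` nonedges (position i)
    & determined (position i) e].
    move: dec; rewrite /determined; case: b => -[-> ->]; split=> //; try by right.
    + by left; left.
    + by right; left.
  have [->|jk] := pselect (j = k); first by split=> //; exists e.
  have [kj|jk'] := stage_le_total k j.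
    by case: ki => _ []; exists j; split=> //; split=> // kj'; apply: jk.
  have [ej nj _] := IH k ki.1 j (conj jk' jk).
  split; [exact: subset_trans ek|exact: subset_trans nk|].
  by exists e => // -[/ej|/nj] ?; apply: nke; [left|right].
- have lim : is_limit le i by split=> // z; apply: z; exists j.
  have [Ei Ni] := position_limit lim.
  have sub k : before le k i -> edges (position k) `<=` edges (position i) /\
      nonedges (position k) `<=` nonedges (position i).
    by move=> ki; rewrite Ei Ni; split=> e ke; exists k.
  have [ej nj] := sub j ji; split=> //.
  have [k [jk ki]] : exists k, before le j k /\ before le k i.
    by apply: contrapT => nk; apply: nsucc; exists j.
  have [_ _ [e ke nje]] := IH k ki j jk; exists e => //.
  by have [ek nk] := sub k ki; case: ke => [/ek|/nk]; [left|right].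
Qed.

Lemma position_le i j : le j i <->
  edges (position j) `<=` edges (position i) /\
  nonedges (position j) `<=` nonedges (position i).
Proof.
have [->|ji] := pselect (j = i); first by split=> _; [split|exact: stage_lexx].
split=> [le_ji|[ej nj]]; first by have [] := @position_lt i j (conj le_ji ji).
have [ij|//] := stage_le_total i j.
have [|_ _ [e [/ej|/nj] je ie]] := @position_lt j i; first by split=> // /esym.
- by case: ie; left.
- by case: ie; right.
Qed.

End RunTheory.

(* Main.v *)
(** Bob plays greedily: he declares an edge unless this creates a vertex of
    degree [n]. Then no vertex ever has [n] edges, and each nonedge has an end
    with [n - 1] edges. Hence the game can only end because the graph of all
    edges and undetermined pairs has maximal degree less than [n]. In that graph
    the vertices with fewer than [n - 1] edges form a clique, so there are at
    most [n] of them; and an undetermined pair has both ends among them, since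
    it adds to the degrees of its ends.

    The run in which Bob answers Alice's strategy in this way is obtained by
    recursion along a well-order of the sets of pregraphs; it terminates since
    its positions are distinct and there are more sets of pregraphs than
    pregraphs. *)

Require Import Defs.
From mathcomp Require Import all_boot finmap.
From mathcomp Require Import boolp classical_sets wochoice.

Set Implicit Arguments.
Unset Strict Implicit.
Unset Printing Implicit Defensive.

Local Open Scope classical_set_scope.

Lemma sval_prop_inj (X : Type) (S : X -> Prop) : injective (@sval X S).
Proof. by move=> [x Sx] [y Sy] /= xy; exact: eq_exist. Qed.

(** * Well-orders on an arbitrary type *)

Section WellOrder.
Variables (X : Type) (le : rel X).
Hypothesis wo : well_order le.
Implicit Types x y z : X.

Lemma wo_min (P : X -> Prop) :
  (exists x, P x) -> exists2 x, P x & forall y, P y -> le x y.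
Proof.
move=> [x Px]; have [|z [[zP zmin] _]] := wo (A := [pred x | `[< P x >]]).
  by exists x; rewrite inE.
exists z; first by move: zP; rewrite inE.
by move=> y Py; apply: zmin; rewrite inE.
Qed.

Lemma wo_total x y : le x y \/ le y x.
Proof.
have [|z [] -> zmin] := @wo_min (fun z => z = x \/ z = y).
- by exists x; left.
- by left; apply: zmin; right.
- by right; apply: zmin; left.
Qed.

Lemma wo_refl x : le x x.
Proof. by case: (wo_total x x). Qed.

Lemma wo_anti x y : le x y -> le y x -> x = y.
Proof.
move=> xy yx; have [|z [_ uz]] := wo (A := [pred t | `[< t = x \/ t = y >]]).
  by exists x; rewrite inE; left.
have <- : z = x.
  apply: uz; split=> [|t]; rewrite inE; first by left.
  by move=> [->|->] //; exact: wo_refl.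
apply: uz; split=> [|t]; rewrite inE; first by right.
by move=> [->|->] //; exact: wo_refl.
Qed.

Lemma wo_trans x y z : le x y -> le y z -> le x z.
Proof.
move=> xy yz.
have [|t tP tmin] := @wo_min (fun t => [\/ t = x, t = y | t = z]).
  by exists x; constructor 1.
have tx : le t x by apply: tmin; constructor 1.
have ty : le t y by apply: tmin; constructor 2.
have tz : le t z by apply: tmin; constructor 3.
case: tP => tE; move: tx ty tz; rewrite tE // => tx ty tz.
- by rewrite (wo_anti xy tx).
- by rewrite -(wo_anti yz ty).
Qed.

Lemma before_or_le x y : before le x y \/ le y x.
Proof.
have [->|xy] := pselect (x = y); first by right; exact: wo_refl.
by case: (wo_total x y); [left|right].
Qed.

Lemma before_irrefl x y : before le x y -> ~ le y x.
Proof. by case=> xy nxy yx; apply: nxy; exact: wo_anti. Qed.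

Lemma before_trans x y z : before le x y -> before le y z -> before le x z.
Proof.
move=> [xy nxy] [yz nyz]; split; first exact: wo_trans yz.
by move=> xz; apply: nyz; apply: wo_anti => //; rewrite -xz.
Qed.

Lemma before_wf : well_founded (before le).
Proof.
move=> x; apply: contrapT => nx.
have [|{nx}x nx xmin] := @wo_min (fun x => ~ Acc (before le) x); first by exists x.
apply: nx; constructor=> y yx; apply: contrapT => /xmin.
exact: before_irrefl.
Qed.

Lemma well_order_sig (S : X -> Prop) :
  well_order (fun u v : {x | S x} => le (sval u) (sval v)).
Proof.
move=> A [u uA].
have [|x [v vA <-] vmin] := @wo_min (fun x => exists2 v, v \in A & sval v = x).
  by exists (sval u), u.
exists v; split=> [|w [wA wmin]]; first by split=> // w wA; apply: vmin; exists w.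
apply: sval_prop_inj; apply: wo_anti; first by apply: vmin; exists w.
exact: wmin.
Qed.

End WellOrder.

(** Cantor's diagonal argument: [f D] would lie in [D] exactly when it does not. *)
Lemma no_injection_from_powerset (T : Type) (f : set T -> T) : ~ injective f.
Proof.
move=> finj; pose D := [set t | exists2 A, f A = t & ~ A t].
have nD : ~ D (f D) by move=> [A /finj -> nD]; apply: (nD); exists D.
by apply: (nD); exists D.
Qed.

(** * Pregraphs: order, extensions and unions of chains *)

Section Pregraphs.
Variable V : choiceType.
Implicit Types (G : pregraph V) (H : set (pregraph V)) (E N : set (upair V)).

Definition subpregraph G G' : Prop :=
  edges G `<=` edges G' /\ nonedges G `<=` nonedges G'.

Lemma subpregraph_trans G1 G2 G3 :
  subpregraph G1 G2 -> subpregraph G2 G3 -> subpregraph G1 G3.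
Proof.
move=> [e1 n1] [e2 n2].
by split; [exact: subset_trans e2|exact: subset_trans n2].
Qed.

Lemma subpregraph_anti G G' : subpregraph G G' -> subpregraph G' G -> G = G'.
Proof.
case: G G' => E N d [E' N' d'] [/= ee nn] [/= ee' nn'].
have eE : E = E' by apply/seteqP.
have eN : N = N' by apply/seteqP.
by move: d'; rewrite -eE -eN => d'; rewrite (Prop_irrelevance d d').
Qed.

Lemma determined_sub G G' :
  subpregraph G G' -> determined G `<=` determined G'.
Proof. by move=> [ee nn] e [/ee|/nn]; [left|right]. Qed.

(** Every graph extending [G] lies between two extreme ones: the edges alone, treated here, and the
    complement of the nonedges, treated next. *)
Lemma extends_edges G : extends (edges G) G.
Proof. by split=> //; exact: edges_nonedges_disjoint. Qed.

Lemma extends_not_nonedges G : extends (~` nonedges G) G.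
Proof.
split=> [e Ge Ne|]; last by rewrite setICl.
by have : set0 e by rewrite -(edges_nonedges_disjoint G).
Qed.

(** A total pregraph has a single extension. Contrapositively, an undecided position leaves a legal
    move. *)
Lemma decided_total (R : set (set (upair V))) G :
  (forall e, determined G e) -> decided R G.
Proof.
move=> dG; have ext E : extends E G -> E = edges G.
  move=> [GE EN]; apply/seteqP; split=> // e Ee; case: (dG e) => // Ne.
  by have : set0 e by rewrite -EN.
have [RG|nRG] := pselect (R (edges G)); [left|right] => E /ext -> //.
Qed.

(* The empty pregraph when [E] and [N] meet. *)
Definition pregraph_of E N : pregraph V :=
  if pselect (E `&` N = set0) is left d then Pregraph d
  else Pregraph (set0I set0).

Lemma pregraph_ofE E N : E `&` N = set0 ->
  edges (pregraph_of E N) = E /\ nonedges (pregraph_of E N) = N.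
Proof. by rewrite /pregraph_of; case: pselect. Qed.

Definition declare (e : upair V) (b : bool) G : pregraph V :=
  if b then pregraph_of (e |` edges G) (nonedges G)
  else pregraph_of (edges G) (e |` nonedges G).

Lemma declareP e b G : ~ determined G e -> declares e b G (declare e b G).
Proof.
move=> ndG; have d := edges_nonedges_disjoint G.
rewrite /declares /declare; case: b; apply: pregraph_ofE.
- by rewrite setIUl d setU0 -subset0 => x [-> ?]; apply: ndG; right.
- by rewrite setIUr d setU0 -subset0 => x [? xe]; apply: ndG; left; rewrite -xe.
Qed.

Lemma declares_sub e b G G' : declares e b G G' ->
  subpregraph G G' /\ determined G' e.
Proof.
rewrite /declares /determined /subpregraph.
case: b => -[-> ->]; split; try by split=> // x; right.
- by left; left.
- by right; left.
Qed.

Definition pregraph_union H : pregraph V :=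
  pregraph_of (\bigcup_(G in H) edges G) (\bigcup_(G in H) nonedges G).

(** A pair that is an edge in one member and a nonedge in another would be both in the larger of the
    two. *)
Lemma pregraph_unionE H :
  (forall G G', H G -> H G' -> subpregraph G G' \/ subpregraph G' G) ->
  edges (pregraph_union H) = \bigcup_(G in H) edges G /\
  nonedges (pregraph_union H) = \bigcup_(G in H) nonedges G.
Proof.
move=> chain; apply: pregraph_ofE; rewrite -subset0 => e [[G HG Ge] [G' HG' Ge']].
case: (chain _ _ HG HG') => -[ee nn].
- by rewrite -(edges_nonedges_disjoint G'); split=> //; exact: ee.
- by rewrite -(edges_nonedges_disjoint G); split=> //; exact: nn.
Qed.

End Pregraphs.

(** * The run in which Bob answers Alice by a given rule *)

Section BobRun.
Variables (V : choiceType) (R : set (set (upair V))).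
Variables (sigma : set (pregraph V) -> upair V).
Variable bob : pregraph V -> upair V -> bool.
Variables (X : Type) (le : rel X).
Hypothesis wo : well_order le.
Implicit Types (G : pregraph V) (H : set (pregraph V)) (x y z : X).

(* [sigma] is known to be legal only on histories of runs, so that a run has to
   be constructed before the legality of its moves can be used: meanwhile an
   illegal move is replaced by an arbitrary legal one. *)
Definition legal_move H G : upair V :=
  if pselect (determined G (sigma H)) then
    if pselect (exists e, ~ determined G e) is left w then sval (cid w)
    else sigma H
  else sigma H.

Lemma legal_moveP H G : ~ decided R G -> ~ determined G (legal_move H G).
Proof.
move=> ndG; rewrite /legal_move; case: pselect => //= _.
case: pselect => [w|nw]; first exact: (svalP (cid w)).
by move=> _; apply: ndG; apply: decided_total => e; apply: contrapT => ne;
  apply: nw; exists e.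
Qed.

Lemma legal_moveE H G : ~ determined G (sigma H) -> legal_move H G = sigma H.
Proof. by rewrite /legal_move; case: pselect. Qed.

(* The union of a chain [H] belongs to [H] iff [H] has a last element, i.e., iff
   the position that follows [H] is at a successor stage. *)
Definition next_position H : pregraph V :=
  let G := pregraph_union H in
  if `[< H G >] then let e := legal_move H G in declare e (bob G e) G else G.

Definition pos : X -> pregraph V :=
  Fix (before_wf wo) (fun=> pregraph V)
    (fun x rec => next_position [set G | exists y (p : before le y x), rec y p = G]).

Definition past x : set (pregraph V) := [set pos y | y in before le ^~ x].

Lemma posE x : pos x = next_position (past x).
Proof.
rewrite /pos Fix_eq => [|{}x f g fg].
  congr next_position; apply/seteqP; split=> [G [y [p <-]]|G [y p <-]].
  - by exists y.
  - by exists y, p.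
congr next_position; apply/seteqP; split=> G [y [p <-]]; exists y, p;
  by rewrite fg.
Qed.

(** These elements form an initial segment of [X], which supplies the stages of the run: it includes
    the first decided position, if there is one, and stops there. *)
Definition alive x : Prop := forall y, before le y x -> ~ decided R (pos y).

Lemma alive_before x y : alive x -> before le y x -> alive y.
Proof. by move=> ax yx z zy; apply: ax; exact: (before_trans wo) yx. Qed.

(** By transfinite induction the earlier positions form a chain. If their union is one of them,
    declaring a new pair makes the increase strict; otherwise the union differs from all of them. *)
Lemma pos_lt x : alive x -> forall y, before le y x ->
  subpregraph (pos y) (pos x) /\ pos y <> pos x.
Proof.
elim/(well_founded_induction (before_wf wo)): x => x IH ax y yx.
have [eG nG] : edges (pregraph_union (past x)) = \bigcup_(G in past x) edges G /\
    nonedges (pregraph_union (past x)) = \bigcup_(G in past x) nonedges G.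
  apply: pregraph_unionE => _ _ [z zx <-] [t tx <-].
  have [zt|tz] := before_or_le wo z t.
    by left; have [] := IH t tx (alive_before ax tx) z zt.
  have [->|ntz] := pselect (t = z); first by left; split.
  by right; have [] := IH z zx (alive_before ax zx) t (conj tz ntz).
have sub z : before le z x -> subpregraph (pos z) (pregraph_union (past x)).
  by move=> zx; split=> e ez; rewrite ?eG ?nG; exists (pos z) => //; exists z.
rewrite (posE x) /next_position; case: asboolP => [[z zx zG]|nG'].
- rewrite -zG.
  set e := legal_move _ _; have ne : ~ determined (pos z) e.
    by apply: legal_moveP; exact: ax.
  have [zsub ed] := declares_sub (declareP (bob (pos z) e) ne).
  have := sub y yx; rewrite -zG => yz.
  split; first exact: subpregraph_trans zsub.
  move=> yE; apply: ne; apply: (determined_sub yz); by rewrite yE.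
- split; first exact: sub.
  by move=> yE; apply: nG'; exists y.
Qed.

Lemma pos_le x y : alive x -> le y x -> subpregraph (pos y) (pos x).
Proof.
move=> ax yx; have [->|nyx] := pselect (y = x); first by split.
by have [] := pos_lt ax (conj yx nyx).
Qed.

Lemma union_pastE x : alive x ->
  edges (pregraph_union (past x)) = \bigcup_(y in before le ^~ x) edges (pos y) /\
  nonedges (pregraph_union (past x)) =
    \bigcup_(y in before le ^~ x) nonedges (pos y).
Proof.
move=> ax; rewrite -!(bigcup_image _ pos); apply: pregraph_unionE.
move=> _ _ [z zx <-] [t tx <-]; have [zt|tz] := wo_total wo z t.
- by left; apply: pos_le => //; exact: alive_before tx.
- by right; apply: pos_le => //; exact: alive_before zx.
Qed.

Lemma pos_union x : alive x -> ~ past x (pregraph_union (past x)) ->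
  edges (pos x) = \bigcup_(y in before le ^~ x) edges (pos y) /\
  nonedges (pos x) = \bigcup_(y in before le ^~ x) nonedges (pos y).
Proof.
move=> ax nG; rewrite -(union_pastE ax).1 -(union_pastE ax).2 (posE x).
by rewrite /next_position; case: asboolP.
Qed.

Local Notation bstage := {x | alive x}.
Definition bstage_le (u v : bstage) : bool := le (sval u) (sval v).
Definition bposition (u : bstage) : pregraph V := pos (sval u).

Lemma before_sval (u v : bstage) :
  before bstage_le u v <-> before le (sval u) (sval v).
Proof.
split=> -[uv nuv]; split=> // e; apply: nuv; first exact: sval_prop_inj.
by rewrite e.
Qed.

Lemma before_bstage (v : bstage) y : before le y (sval v) ->
  exists2 u : bstage, sval u = y & before bstage_le u v.
Proof.
move=> yv; have ay := alive_before (svalP v) yv.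
by exists (exist _ y ay) => //; apply/before_sval.
Qed.

(** The recursion sees only the [past]; at a successor stage this is the history that Alice's
    strategy reads. *)
Lemma past_succ (u v : bstage) : is_succ bstage_le u v ->
  past (sval v) = [set bposition w | w in [set w | bstage_le w u]].
Proof.
move=> [uv nuv]; apply/seteqP; split=> [_ [y yv <-]|_ [w wu <-]].
- have [w <- wv] := before_bstage yv; exists w => //.
  have [uw|//] := before_or_le wo (sval u) (sval w).
  by case: nuv; exists w; split=> //; apply/before_sval.
- exists (sval w) => //; have /before_sval uv' := uv.
  split; first exact: (wo_trans wo) wu uv'.1.
  by move=> wv; apply: (before_irrefl wo uv'); rewrite -wv.
Qed.

Lemma union_past_succ (u v : bstage) : is_succ bstage_le u v ->
  pregraph_union (past (sval v)) = bposition u.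
Proof.
move=> uv; have [eG nG] := union_pastE (svalP v).
have uv' : before le (sval u) (sval v) by apply/before_sval; case: uv.
have le_u y : before le y (sval v) -> subpregraph (pos y) (bposition u).
  move=> yv; have : past (sval v) (pos y) by exists y.
  by rewrite (past_succ uv) => -[w wu <-]; apply: pos_le => //; exact: svalP.
apply: subpregraph_anti; split; rewrite ?eG ?nG.
- by apply: bigcup_sub => y /le_u[].
- by apply: bigcup_sub => y /le_u[].
- by move=> e ue; exists (sval u).
- by move=> e ue; exists (sval u).
Qed.

Lemma bposition_succ (u v : bstage) : is_succ bstage_le u v ->
  let e := legal_move [set bposition w | w in [set w | bstage_le w u]]
             (bposition u) in
  ~ determined (bposition u) e /\
  declares e (bob (bposition u) e) (bposition u) (bposition v).
Proof.
move=> uv e; have /before_sval uv' := uv.1.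
have ne : ~ determined (bposition u) e.
  by apply: legal_moveP; exact: (svalP v).
split=> //; rewrite [bposition v]posE /next_position (union_past_succ uv).
case: asboolP => [_|[]]; last by exists (sval u).
by rewrite (past_succ uv); exact: declareP.
Qed.

Lemma bposition_zero (u : bstage) : is_zero bstage_le u ->
  edges (bposition u) = set0 /\ nonedges (bposition u) = set0.
Proof.
move=> u0; have nb y : ~ before le y (sval u).
  by move=> yu; have [w _ wu] := before_bstage yu; apply: u0; exists w.
have [|-> ->] := pos_union (svalP u); first by case=> y /nb.
by split; rewrite -subset0 => e [y /nb].
Qed.

Lemma bigcup_before (T : Type) (F : X -> set T) (u : bstage) :
  \bigcup_(y in before le ^~ (sval u)) F y =
  \bigcup_(w in before bstage_le ^~ u) F (sval w).
Proof.
apply/seteqP; split=> t [y yu Ft].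
- by have [w wy wu] := before_bstage yu; exists w => //; rewrite wy.
- by exists (sval y) => //; apply/before_sval.
Qed.

Lemma bposition_limit (u : bstage) : is_limit bstage_le u ->
  edges (bposition u) = \bigcup_(w in before bstage_le ^~ u) edges (bposition w)
  /\ nonedges (bposition u) =
       \bigcup_(w in before bstage_le ^~ u) nonedges (bposition w).
Proof.
move=> [_ nsucc].
rewrite -(bigcup_before (fun x => edges (pos x))).
rewrite -(bigcup_before (fun x => nonedges (pos x))).
apply: pos_union (svalP u) _ => -[y yu yG].
(* If the union were attained at [w], then [u] would be a successor of [w]: a position in between
   would be squeezed between equal ones, against strict increase. *)
have [w wy wu] := before_bstage yu; apply: nsucc; exists w; split=> // -[t [wt tu]].
have /before_sval wt' := wt; have /before_sval tu' := tu.
have [wt1 wt2] := pos_lt (svalP t) wt'.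
apply: wt2; apply: subpregraph_anti => //; rewrite wy yG.
have [eG nG] := union_pastE (svalP u).
by split; rewrite ?eG ?nG; move=> e te; exists (sval t).
Qed.

Lemma bundecided_before (u v : bstage) : before bstage_le u v ->
  ~ decided R (bposition u).
Proof. by move=> /before_sval; exact: (svalP v). Qed.

Lemma bposition_succ_legal (u v : bstage) : is_succ bstage_le u v ->
  exists e b, ~ determined (bposition u) e /\
    declares e b (bposition u) (bposition v).
Proof. by move=> /bposition_succ[]; eauto. Qed.

Definition bob_run : run R :=
  Run (well_order_sig wo (S := alive) : well_order bstage_le) bposition_zero bposition_succ_legal bposition_limit
    bundecided_before.

(** If no position is decided, all of [X] is alive, and strict increase makes [pos] injective. *)
Lemma bob_run_terminates : (forall f : X -> pregraph V, ~ injective f) ->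
  exists i : stage bob_run, decided R (position i).
Proof.
move=> ninj; apply: contrapT => nd.
have all_alive x : alive x.
  elim/(well_founded_induction (before_wf wo)): x => x IH y yx dy.
  by apply: nd; exists (exist _ y (IH y yx)).
apply: (ninj pos) => x y xy.
have [/(pos_lt (all_alive y))[]//|yx] := before_or_le wo x y.
have [//|nyx] := pselect (y = x).
by have [_ /(_ (esym xy))] := pos_lt (all_alive x) (conj yx nyx).
Qed.

End BobRun.

Lemma play_against (V : choiceType) (R : set (set (upair V)))
    (sigma : set (pregraph V) -> upair V) (bob : pregraph V -> upair V -> bool) :
  alice_strategy R sigma ->
  exists2 r : run R,
    forall j i : stage r, is_succ (@stage_le V R r) j i ->
      let e := sigma (history j) in
      ~ determined (position j) e /\
      declares e (bob (position j) e) (position j) (position i)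
  & exists i : stage r, decided R (position i).
Proof.
move=> legal.
have [le wo] := well_ordering_principle {classic (set (pregraph V))}.
exists (bob_run R sigma bob wo); last first.
  by apply: bob_run_terminates => f; exact: (@no_injection_from_powerset _ f).
move=> j i ji e.
(* Legality applies to the completed run, so [legal_move] agrees with [sigma] along it. *)
have ne : ~ determined (position j) e.
  by apply: legal; case: ji => ji _; exact: undecided_before ji.
by have := bposition_succ ji; rewrite legal_moveE.
Qed.

(** * Stars with a given center *)

Section Stars.
Variable V : choiceType.
Implicit Types (E : set (upair V)) (c x y : V) (L : {fset V}).

(** Encodes that [c] has degree at least [k], where the degree may be infinite. *)
Definition star_at E c k : Prop := exists L : {fset V},
  [/\ #|` L| = k, c \notin L & forall x, x \in L -> adjacent E c x].

Lemma adjacent_sub E E' c x : E `<=` E' -> adjacent E c x -> adjacent E' c x.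
Proof. by move=> EE' [e Ee eE]; exists e => //; exact: EE'. Qed.

Lemma star_at_sub E E' c k : E `<=` E' -> star_at E c k -> star_at E' c k.
Proof.
move=> EE' [L [Lk cL adj]]; exists L; split=> // x /adj.
exact: adjacent_sub.
Qed.

Lemma upair_ex x y : x != y -> exists e : upair V, sval e = [fset x; y]%fset.
Proof.
move=> xy; have c2 : #|` [fset x; y]%fset| == 2 by rewrite cardfs2 xy.
by exists (exist (fun e : {fset V} => #|` e| == 2) _ c2).
Qed.

Lemma upair_other (e : upair V) x : x \in sval e ->
  exists2 y, y != x & sval e = [fset x; y]%fset.
Proof.
move=> xe; have /eqP := svalP e; rewrite (cardfsD1 x) xe add1n => -[] /eqP.
move=> /cardfs1P[y ye]; exists y.
  by have : y \in (sval e `\ x)%fset; [rewrite ye inE | rewrite !inE => /andP[]].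
by rewrite -(fsetD1K xe) ye.
Qed.

Lemma upair_inj (e e' : upair V) : sval e = sval e' -> e = e'.
Proof. exact: val_inj. Qed.

(* Adding one edge creates a star only by adding a leaf to a smaller one. *)
Lemma star_at_setU1 E e c k : star_at (e |` E) c k -> ~ star_at E c k ->
  c \in sval e /\ star_at E c k.-1.
Proof.
move=> [L [Lk cL adj]] nst.
have [x [xL ncx]] : exists x, x \in L /\ ~ adjacent E c x.
  apply: contrapT => nx; apply: nst; exists L; split=> // x xL.
  by apply: contrapT => ncx; apply: nx; exists x.
have eE : sval e = [fset c; x]%fset.
  by have [e' [->//|Ee'] e'E] := adj x xL; case: ncx; exists e'.
split; first by rewrite eE !inE eqxx.
(* Dropping the leaf [x] suffices, since [e] joins [c] to no other vertex. *)
exists (L `\ x)%fset; split.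
- by rewrite -Lk (cardfsD1 x L) xL.
- by rewrite !inE (negbTE cL) andbF.
move=> y; rewrite !inE => /andP[yx yL].
have [e' [->|Ee'] e'E] := adj y yL; last by exists e'.
have : y \in sval e by rewrite e'E !inE eqxx orbT.
by rewrite eE !inE (negbTE yx) orbF => /eqP yc; rewrite -yc yL in cL.
Qed.

(** A star has finitely many edges, so one member of the chain contains them all; [D] is nonempty
    for the sake of stars without leaves. *)
Lemma star_at_bigcup (I : Type) (D : set I) (F : I -> set (upair V)) c k :
  D !=set0 ->
  (forall i j, D i -> D j -> F i `<=` F j \/ F j `<=` F i) ->
  star_at (\bigcup_(i in D) F i) c k -> exists2 i, D i & star_at (F i) c k.
Proof.
move=> [i0 Di0] chain [L [Lk cL adj]].
suff [i Di iL] : exists2 i, D i & forall x, x \in (L : seq V) -> adjacent (F i) c x.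
  by exists i => //; exists L.
have {}adj : forall x, x \in (L : seq V) -> adjacent (\bigcup_(i in D) F i) c x.
  exact: adj.
elim: (L : seq V) adj => [|x s IH] adj; first by exists i0.
have [|i Di is_] := IH; first by move=> y ys; apply: adj; rewrite in_cons ys orbT.
have [e [j Dj Fje] ex] := adj x (mem_head _ _).
have xj : adjacent (F j) c x by exists e.
have [ij|ji] := chain _ _ Di Dj.
- exists j => // y; rewrite in_cons => /predU1P[->//|/is_].
  exact: adjacent_sub.
- exists i => // y; rewrite in_cons => /predU1P[->|/is_//].
  exact: adjacent_sub xj.
Qed.

End Stars.

(** * Finite covers of sets of natural numbers *)

Lemma nat_fset_fresh (B : {fset nat}) : exists x, x \notin B.
Proof.
exists (\max_(i <- B) i).+1; apply/negP => xB.
by have := @leq_bigmax_seq _ (B : seq nat) predT id _ xB isT; rewrite ltnn.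
Qed.

(** Induction on [k], removing one element of [P]; fresh numbers pad the cover to exactly [k]
    elements. *)
Lemma fset_cover k (P : set nat) :
  (forall A : {fset nat}, (forall x, x \in A -> P x) -> #|` A| <> k.+1) ->
  exists2 B : {fset nat}, #|` B| = k & forall x, P x -> x \in B.
Proof.
elim: k P => [|k IH] P smallP.
  exists fset0 => [|x Px]; first exact: cardfs0.
  by have [] := smallP [fset x]%fset; rewrite ?cardfs1 // => y /fset1P ->.
suff [B Bk [x xB xP]] : exists2 B : {fset nat}, #|` B| = k &
    exists2 x, x \notin B & forall y, P y -> y \in (x |` B)%fset.
  by exists (x |` B)%fset; rewrite // cardfsU1 xB Bk.
have [[p Pp]|nP] := pselect (exists p, P p); last first.
  have [|B Bk _] := IH set0.
    by move=> A A0 Ak; have /fset0Pn[x /A0//] : A != fset0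
      by rewrite -cardfs_eq0 Ak.
  exists B => //; have [x xB] := nat_fset_fresh B.
  by exists x => // y Py; case: nP; exists y.
have [|B Bk PB] := IH (P `\ p).
  move=> A AP Ak; apply: (smallP (p |` A)%fset) => [x|].
    by rewrite !inE => /predU1P[->//|/AP[]].
  by rewrite cardfsU1 Ak; case: (boolP (p \in A)) => // /AP[_ []].
(* The extra element is [p], unless [B] already contains it; then a fresh number keeps the size
   exact. *)
exists B => //; have [pB|pB] := boolP (p \in B).
- have [x xB] := nat_fset_fresh B; exists x => // y Py.
  have [->|/eqP yp] := eqVneq y p; first by rewrite !inE pB orbT.
  by rewrite !inE PB ?orbT.
- exists p => // y Py; rewrite !inE; case: eqVneq => //= /eqP yp.
  exact: PB.
Qed.

(** * The greedy rule and the positions where it ends *)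

Section Greedy.
Variable n : nat.
Hypothesis n_gt0 : 0 < n.
Implicit Types G : pregraph nat.

Definition greedy G (e : upair nat) : bool :=
  `[< ~ contains_star n (e |` edges G) >].

Definition greedy_invariant G : Prop := ~ contains_star n (edges G) /\
  forall e, nonedges G e -> exists2 c, c \in sval e & star_at (edges G) c n.-1.

(** A refused pair would complete a star, whose center is an end of the pair and already has [n.-1]
    edges. Later edges preserve this. *)
Lemma greedy_invariant_declares G G' e :
  greedy_invariant G -> declares e (greedy G e) G G' -> greedy_invariant G'.
Proof.
rewrite /greedy_invariant /declares /greedy => -[nst nonE].
case: asboolP => [nst'|/contrapT[c st]] [-> ->]; split=> //.
- move=> e' /nonE[c ce' st]; exists c => //; apply: star_at_sub st.
  by move=> ? ?; right.
- move=> e' [->|/nonE//].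
  have [|ce st'] := star_at_setU1 st; last by exists c.
  by move=> st'; apply: nst; exists c.
Qed.

(** At a limit stage the edge sets form a chain, so a star with [n] leaves would already occur
    earlier. *)
Lemma greedy_invariant_run (r : run (contains_star n)) :
  (forall j i : stage r, is_succ (@stage_le _ _ r) j i ->
    exists e, declares e (greedy (position j) e) (position j) (position i)) ->
  forall i : stage r, greedy_invariant (position i).
Proof.
move=> rgreedy i; apply: contrapT => nI.
have [|{nI}i nI imin] := @stage_min _ _ r (fun i => ~ greedy_invariant (position i)).
  by exists i.
have {imin} IH j : before (@stage_le _ _ r) j i -> greedy_invariant (position j).
  by move=> [ji nji]; apply: contrapT => /imin ij; apply: nji; exact: stage_le_anti.
apply: nI.
have [i0|ni0] := pselect (is_zero (@stage_le _ _ r) i).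
  have [E0 N0] := position_zero i0; rewrite /greedy_invariant E0 N0; split=> //.
  (* As [n] is positive, the star has a leaf, impossible without edges. *)
  move=> [c [L [Ln _ adj]]]; have [x /adj[]//] : exists x, x \in L.
  by apply/fset0Pn; rewrite -cardfs_eq0 Ln -lt0n.
have [[j ji]|nsucc] := pselect (exists j, is_succ (@stage_le _ _ r) j i).
  have [e dec] := rgreedy j i ji.
  by apply: greedy_invariant_declares dec; apply: IH; case: ji.
have [Ei Ni] := position_limit (conj ni0 nsucc).
split.
- rewrite Ei => -[c st]; have [||j] := star_at_bigcup _ _ st.
  + exact: contrapT ni0.
  + move=> j k _ _; have [jk|kj] := stage_le_total j k.
    * by left; have [] := (position_le k j).1 jk.
    * by right; have [] := (position_le j k).1 kj.
  by move=> /IH[nst _] st'; apply: nst; exists c.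
- move=> e; rewrite Ni => -[j ji je].
  have [c ce st] := (IH j ji).2 e je; exists c => //.
  by apply: star_at_sub st; rewrite Ei => e' je'; exists j.
Qed.

Lemma greedy_cofinite G : greedy_invariant G -> decided (contains_star n) G ->
  cofinite_family n (determined G).
Proof.
(* The least extension has no star, so the game was decided negatively and the greatest extension
   has none either. *)
move=> [nst nonE] [/(_ _ (extends_edges G))//|/(_ _ (extends_not_nonedges G)) nst'].
(* By the invariant, a nonedge has an end with [n.-1] edges. *)
have adjM x y : x != y -> ~ star_at (edges G) x n.-1 ->
    ~ star_at (edges G) y n.-1 -> adjacent (~` nonedges G) x y.
  move=> xy nx ny; have [e eE] := upair_ex xy; exists e => // /nonE[c].
  by rewrite eE !inE => /orP[]/eqP ->.
(* By [adjM] the vertices of edge degree < n.-1 form a clique of potential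
   edges, which would contain the star if it had more than n vertices. *)
have [|B Bn lowB] := @fset_cover n [set v | ~ star_at (edges G) v n.-1].
  move=> A lowA An; have /fset0Pn[c cA] : A != fset0 by rewrite -cardfs_eq0 An.
  apply: nst'; exists c, (A `\ c)%fset; split.
  - by move: An; rewrite (cardfsD1 c) cA => -[].
  - by rewrite !inE eqxx.
  - move=> x; rewrite !inE => /andP[xc xA].
    by apply: adjM; [rewrite eq_sym|exact: lowA|exact: lowA].
(* If an end [u] of the undetermined pair [e] had [n.-1] edges, then [e] would add one more leaf and
   give a star with [n] leaves in the greatest extension. *)
exists B => // e ne; apply/fsubsetP => u ue; apply: lowB => -[L [Ln uL adj]].
have [v vu eE] := upair_other ue.
apply: nst'; exists u, (v |` L)%fset; split.
- rewrite cardfsU1 Ln; case: (boolP (v \in L)) => [/adj[e' Ge']|_].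
    by rewrite -eE => /upair_inj e'e; case: ne; left; rewrite -e'e.
  by rewrite add1n prednK.
- by rewrite !inE negb_or eq_sym vu.
- move=> x; rewrite !inE => /predU1P[->|/adj].
    by exists e => // Ne; apply: ne; right.
  by apply: adjacent_sub; have [] := extends_not_nonedges G.
Qed.

End Greedy.

Theorem theorem4p16 (n : nat) (n_ge1 : (1 <= n)%N) :
  hard (cofinite_family n) (contains_star n).
Proof.
move=> [sigma [legal win]].
have [r rgreedy [i di]] := play_against (greedy n) legal.
apply: (win r i _ di) => [j k /rgreedy[_ dec]|]; first by eexists; exact: dec.
apply: greedy_cofinite di => //; apply: greedy_invariant_run => // j k /rgreedy[_ dec].
by eexists; exact: dec.
Qed.
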